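(* Under the standing assumptions (A1)–(A5) listed in the context, for any $i\in\mathbb{Z}_{\ge 0}$, any $x\in\mathbb{R}^{n_x}$, any $\gamma\in(\gamma^\star,\gamma_0)$ and any solution $\phi^\star_\gamma(\cdot,x)$, initialized at $x$, to the optimally controlled system $x(k+1)\in F^\star_\gamma(x(k))$, $$\big(V^i_\gamma-V^\star_\gamma\big)(x)\le \gamma^i\big(V^0_\gamma-V^\star_\gamma\big)\big(\phi^\star_\gamma(i,x)\big)\le \gamma^i\,\overline{\alpha}_V\big(\beta^\star_\gamma(\sigma(x),i),\gamma\big),$$ where $V^i_\gamma$ is the cost function generated by policy iteration at iteration $i$ and $\beta^\star_\gamma\in\mathcal{KL}$ and $\overline{\alpha}_V$ are given in the context.
   Context: **Comparison functions.** $\mathcal{K}_\infty$: continuous, strictly increasing, unbounded functions $\mathbb{R}_{\ge 0}\to\mathbb{R}_{\ge 0}$ that are zero at zero. $\mathcal{KL}$: functions $\beta(s,k)\ge 0$ nondecreasing in $s$, nonincreasing in $k$, with $\lim_{s\to 0^+}\beta(s,k)=0$ for each $k$ and $\lim_{k\to\infty}\beta(s,k)=0$ for each $s$. $\mathbb{I}$ is the identity on $\mathbb{R}_{\ge 0}$; $g^{(k)}$ is the $k$-fold composition of $g$, with $g^{(0)}=\mathbb{I}$. **System and cost.** $x(k+1)=f(x(k),u(k))$, $k\in\mathbb{Z}_{\ge 0}$, with state $x\in\mathbb{R}^{n_x}$ and input $u\in\mathcal{U}(x)\subseteq\mathbb{R}^{n_u}$, $\mathcal{U}(x)\neq\emptyset$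 being the set of admissible inputs at $x$; a policy $h:\mathbb{R}^{n_x}\to\mathbb{R}^{n_u}$ is admissible ($h\in\mathcal{U}$) if $h(x)\in\mathcal{U}(x)$ for all $x$. For a stage cost $\ell:\mathbb{R}^{n_x}\times\mathbb{R}^{n_u}\to\mathbb{R}_{\ge0}$ and $\gamma\in(0,1)$, $J_\gamma(x,\boldsymbol{u})=\sum_{k=0}^\infty\gamma^k\ell(\phi(k,x,\boldsymbol{u}|_k),u(k))$, where $\phi(k,x,\boldsymbol{u}|_k)$ is the solution at time $k$ from $x$ under the admissible input sequence $\boldsymbol{u}$; $J_\gamma(x,h)$ is the cost when the inputs are generated by the feedback $h$. $V^\star_\gamma(x)=\min_{\boldsymbol{u}}J_\gamma(x,\boldsymbol{u})$, $H^\star_\gamma(x)=\operatorname{argmin}_{u\in\mathcal{U}(x)}\{\ell(x,u)+\gamma V^\star_\gamma(f(x,u))\}$ and $F^\star_\gamma(x)=f(x,H^\star_\gamma(x))$. **Policy iteration (PI).** Given $\gamma$ and an admissible initial policy $h^0$: $V^0_\gamma(x)=J_\gamma(x,h^0)$; for $i\in\mathbb{Z}_{\ge0}$, $H^{i+1}_\gamma(x)=\operatorname{argmin}_{u\in\mathcal{U}(x)}\{\ell(x,u)+\gamma V^i_\gamma(f(x,u))\}$, an arbitrary selection $h^{i+1}_\gamma\in H^{i+1}_\gamma$ is chosen (i.e. $h^{i+1}_\gamma(x)\in H^{i+1}_\gamma(x)$ for all $x$), and $V^{i+1}_\gamma(x)=J_\gamma(x,h^{i+1}_\gamma)$. **State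 measure.** $\sigma:\mathbb{R}^{n_x}\to\mathbb{R}_{\ge0}$ is continuous and radially unbounded ($\{x:\sigma(x)\le\Delta\}$ is compact for every $\Delta>0$); it vanishes on the attractor of interest. **Standing assumptions.** (A1) For every $x\in\mathbb{R}^{n_x}$ and $\gamma\in(0,1)$ there is an admissible input sequence attaining the minimum $V^\star_\gamma(x)<+\infty$. (A2) $H^i_\gamma(x)\ne\emptyset$ for all $i\in\mathbb{Z}_{>0}$, $x\in\mathbb{R}^{n_x}$ (for the discount factors $\gamma$ considered). (A3) There exist a continuous $W:\mathbb{R}^{n_x}\to\mathbb{R}_{\ge0}$, $\alpha_W\in\mathcal{K}_\infty$ and a continuous, nondecreasing $\overline{\alpha}_W:\mathbb{R}_{\ge0}\to\mathbb{R}_{\ge0}$, zero at zero, such that for all $x\in\mathbb{R}^{n_x}$, $u\in\mathcal{U}(x)$: $W(x)\le\overline{\alpha}_W(\sigma(x))$ and $W(f(x,u))-W(x)\le-\alpha_W(\sigma(x))+\ell(x,u)$. (A4) There exist $\gamma_0\in(0,1]$ and $\overline{\alpha}_V:\mathbb{R}_{\ge0}\times(0,\gamma_0)\to\mathbb{R}_{\ge0}$, of class $\mathcal{K}_\infty$ in its first argument, such that $V^0_\gamma(x)=J_\gamma(x,h^0)\le\overline{\alpha}_V(\sigma(x),\gamma)$ for all $x\in\mathbb{R}^{n_x}$, $\gamma\in(0,\gamma_0)$. (A5) (i) There is $\overline{\alpha}_{V^\star}\in\mathcal{K}_\infty$ with $V^\star_\gamma(x)\le\overline{\alpha}_{V^\star}(\sigma(x))$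 for all $x\in\mathbb{R}^{n_x}$, $\gamma\in(0,\gamma_0)$. (ii) There is $\gamma^\star\in(0,\gamma_0)$ with $(1-\gamma^\star)\overline{\alpha}_{V^\star}(s)\le\alpha_W(s)$ for all $s>0$. **The function $\beta^\star_\gamma$.** For $\gamma\in(\gamma^\star,\gamma_0)$ let $\overline{\alpha}_{Y^\star}=\overline{\alpha}_{V^\star}+\tfrac1{\gamma^\star}\overline{\alpha}_W$, $\alpha_{Y^\star}(\cdot,\gamma)=\tfrac{\gamma-\gamma^\star}{1-\gamma^\star}\alpha_W$, $\widetilde\alpha_{Y^\star}(\cdot,\gamma)=\alpha_{Y^\star}(\overline{\alpha}_{Y^\star}^{-1}(\cdot),\gamma)$, $\widetilde\beta^\star_\gamma(s,k)=\max_{\hat s\in[0,s]}\big(\mathbb{I}-\tfrac1\gamma\widetilde\alpha_{Y^\star}(\cdot,\gamma)\big)^{(k)}(\hat s)$, and $\beta^\star_\gamma(s,k)=\alpha_W^{-1}\big(\widetilde\beta^\star_\gamma(\overline{\alpha}_{Y^\star}(s),k)\big)$. This is a $\mathcal{KL}$ function such that every solution of $x(k+1)\in F^\star_\gamma(x(k))$ from $x$ satisfies $\sigma(\phi^\star_\gamma(k,x))\le\beta^\star_\gamma(\sigma(x),k)$ for all $k\in\mathbb{Z}_{\ge0}$. *)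

(* Defs.v *)
From HB Require Import structures.
From mathcomp Require Import all_boot all_order all_algebra.
From mathcomp Require Import all_classical all_reals all_analysis.

Set Implicit Arguments.
Unset Strict Implicit.
Unset Printing Implicit Defensive.

Import Order.TTheory GRing.Theory Num.Theory.
Import numFieldNormedType.Exports.

Local Open Scope classical_set_scope.
Local Open Scope ring_scope.

(* Functions on the nonnegative half-line are total functions [R -> R] of which
   only the restriction to [`[0, +oo[] matters. *)
Definition class_Kinfty (R : realType) (g : R -> R) : Prop :=
  [/\ {within `[0, +oo[, continuous g},
      (forall s t, 0 <= s -> s < t -> g s < g t),
      (forall M, exists2 s, 0 <= s & M < g s)
    & g 0 = 0].

(* Inverse of [g] as a function on the nonnegative half-line; it takes the
   junk value 0 off the image of the half-line. *)
Definition inv_ge0 (R : realType) (g : R -> R) : R -> R :=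
  'pinv_(fun=> 0) `[0, +oo[ g.

Definition state_measure (R : realType) (nx : nat) (sigma : 'rV[R]_nx -> R) :
    Prop :=
  [/\ (forall x, 0 <= sigma x),
      continuous sigma
    & forall Delta, 0 < Delta -> compact [set x | sigma x <= Delta]].

Fixpoint solution (X I : Type) (f : X -> I -> X) (x : X) (u : nat -> I)
    (k : nat) : X :=
  if k is k'.+1 then f (solution f x u k') (u k') else x.

Definition admissible_inputs (X I : Type) (f : X -> I -> X) (U : X -> set I)
    (x : X) (u : nat -> I) : Prop :=
  forall k, U (solution f x u k) (u k).

Definition admissible_policy (X I : Type) (U : X -> set I) (h : X -> I) :
    Prop :=
  forall x, U x (h x).

Definition feedback_inputs (X I : Type) (f : X -> I -> X) (h : X -> I) (x : X) :
    nat -> I :=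
  fun k => h (iter k (fun y => f y (h y)) x).

(* Costs are extended-real valued since the discounted series of nonnegative
   terms may diverge. *)
Definition cost (R : realType) (X I : Type) (f : X -> I -> X)
    (ell : X -> I -> R) (gamma : R) (x : X) (u : nat -> I) : \bar R :=
  (\sum_(0 <= k <oo) (gamma ^+ k * ell (solution f x u k) (u k))%:E)%E.

Definition policy_cost (R : realType) (X I : Type) (f : X -> I -> X)
    (ell : X -> I -> R) (gamma : R) (h : X -> I) (x : X) : \bar R :=
  cost f ell gamma x (feedback_inputs f h x).

(* The infimum; that it is a minimum is part of [optimal_cost_attained]. *)
Definition optimal_cost (R : realType) (X I : Type) (f : X -> I -> X)
    (U : X -> set I) (ell : X -> I -> R) (gamma : R) (x : X) : \bar R :=
  ereal_inf [set cost f ell gamma x u | u in admissible_inputs f U x].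

Definition optimal_cost_attained (R : realType) (X I : Type) (f : X -> I -> X)
    (U : X -> set I) (ell : X -> I -> R) (gamma : R) (x : X) : Prop :=
  (exists2 u, admissible_inputs f U x u &
     cost f ell gamma x u = optimal_cost f U ell gamma x) /\
  (optimal_cost f U ell gamma x < +oo)%E.

Definition argmin (R : realType) (I : Type) (A : set I) (F : I -> \bar R) :
    set I :=
  [set u | A u /\ forall v, A v -> (F u <= F v)%E].

Definition greedy_inputs (R : realType) (X I : Type) (f : X -> I -> X)
    (U : X -> set I) (ell : X -> I -> R) (gamma : R) (V : X -> \bar R) (x : X) :
    set I :=
  argmin (U x) (fun u => ((ell x u)%:E + gamma%:E * V (f x u))%E).

Definition optimal_inputs (R : realType) (X I : Type) (f : X -> I -> X)
    (U : X -> set I) (ell : X -> I -> R) (gamma : R) : X -> set I :=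
  greedy_inputs f U ell gamma (optimal_cost f U ell gamma).

Definition optimal_solution (R : realType) (X I : Type) (f : X -> I -> X)
    (U : X -> set I) (ell : X -> I -> R) (gamma : R) (x : X) (phi : nat -> X) :
    Prop :=
  phi 0%N = x /\
  forall k, (f (phi k) @` optimal_inputs f U ell gamma (phi k)) (phi k.+1).

(* [improved_inputs f U ell gamma h i x] is the set $H^{i+1}_\gamma(x)$. *)
Definition improved_inputs (R : realType) (X I : Type) (f : X -> I -> X)
    (U : X -> set I) (ell : X -> I -> R) (gamma : R) (h : nat -> X -> I)
    (i : nat) : X -> set I :=
  greedy_inputs f U ell gamma (policy_cost f ell gamma (h i)).

Definition policy_iteration (R : realType) (X I : Type) (f : X -> I -> X)
    (U : X -> set I) (ell : X -> I -> R) (gamma : R) (h0 : X -> I)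
    (h : nat -> X -> I) : Prop :=
  h 0%N = h0 /\ forall i x, improved_inputs f U ell gamma h i x (h i.+1 x).

Definition alpha_Y_bar (R : realType) (aVs_bar aW_bar : R -> R) (gs : R) :
    R -> R :=
  fun s => aVs_bar s + gs^-1 * aW_bar s.

Definition alpha_Y (R : realType) (aW : R -> R) (gs gamma : R) : R -> R :=
  fun s => (gamma - gs) / (1 - gs) * aW s.

Definition alpha_Y_tilde (R : realType) (aVs_bar aW_bar aW : R -> R)
    (gs gamma : R) : R -> R :=
  fun s => alpha_Y aW gs gamma (inv_ge0 (alpha_Y_bar aVs_bar aW_bar gs) s).

(* The supremum is a maximum: the iterated map is continuous, and it is the
   identity on the negative half-line by the junk value of [inv_ge0]. *)
Definition beta_tilde (R : realType) (aVs_bar aW_bar aW : R -> R)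
    (gs gamma : R) (s : R) (k : nat) : R :=
  sup [set iter k
         (fun t => t - gamma^-1 * alpha_Y_tilde aVs_bar aW_bar aW gs gamma t) r
      | r in `[0, s]].

Definition beta_star (R : realType) (aVs_bar aW_bar aW : R -> R)
    (gs gamma : R) (s : R) (k : nat) : R :=
  inv_ge0 aW (beta_tilde aVs_bar aW_bar aW gs gamma
                (alpha_Y_bar aVs_bar aW_bar gs s) k).

(* Main.v *)
(* Comparing the greedy input with an optimal input u, and using policy
   improvement, V^(i+1)(x) <= l(x,u) + gamma V^i(f(x,u)), whereas the optimal
   cost Vs satisfies Vs(x) >= l(x,u) + gamma Vs(f(x,u)); subtracting and
   iterating along the optimal solution gives the first inequality.  For the
   second one,
   Y = Vs + W / gamma is a Lyapunov function: it dominates alpha_W(sigma), is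
   dominated by alpha_Y_bar(sigma), and satisfies
   Y(x+) <= Y(x) - alpha_Y_tilde(Y(x)) / gamma along optimal solutions, so each
   value of Y is an iterate of t |-> t - alpha_Y_tilde(t) / gamma started from
   some point of [0, alpha_Y_bar(sigma(x))]. *)
Require Import Defs.
From HB Require Import structures.
From mathcomp Require Import all_boot all_order all_algebra.
From mathcomp Require Import all_classical all_reals all_analysis.
From mathcomp Require Import lra.
Import Order.TTheory GRing.Theory Num.Theory.
Import numFieldNormedType.Exports.
Local Open Scope classical_set_scope.
Local Open Scope ring_scope.

(** * Inverting class K-infinity functions on the half-line *)

Section ClassKinfty.
Context {R : realType} {g : R -> R}.
Hypothesis gK : class_Kinfty g.

Lemma class_Kinfty_le s t : 0 <= s -> s <= t -> g s <= g t.
Proof.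
case: gK => _ gmono _ _ s0.
by rewrite le_eqVlt => /predU1P[-> //|st]; exact/ltW/gmono.
Qed.

Lemma class_Kinfty_le_inv s t : 0 <= t -> g s <= g t -> s <= t.
Proof.
case: gK => _ gmono _ _ t0 gst.
by rewrite leNgt; apply/negP => /(gmono _ _ t0); rewrite ltNge gst.
Qed.

Lemma class_Kinfty_surj y : 0 <= y -> exists2 s, 0 <= s & g s = y.
Proof.
case: (gK) => gcont _ gunb g0 y0.
have [M M0 yM] := gunb y.
have gM : {within `[0, M], continuous g}.
  apply: continuous_subspaceW gcont => z /=.
  by rewrite !in_itv/= andbT => /andP[].
have [|s + <-] := IVT M0 gM (v := y).
  by rewrite g0 ge_min y0 le_max (ltW yM) orbT.
by rewrite in_itv/= => /andP[s0 _]; exists s.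
Qed.

Lemma inv_ge0K s : 0 <= s -> inv_ge0 g (g s) = s.
Proof.
move=> s0; apply: pinvKV; last by rewrite inE/= in_itv/= s0.
move=> a b; rewrite !inE/= !in_itv/= !andbT => a0 b0 gab.
by apply/eqP; rewrite eq_le; apply/andP; split;
  apply: class_Kinfty_le_inv; rewrite ?gab.
Qed.

Lemma class_Kinfty_inv_ge0 y : 0 <= y -> 0 <= inv_ge0 g y /\ g (inv_ge0 g y) = y.
Proof. by move=> /class_Kinfty_surj[s s0 <-]; rewrite inv_ge0K. Qed.

(** On the image of the half-line the value is a preimage taken there; elsewhere it is the default
    0. *)
Lemma inv_ge0_ge0 y : 0 <= inv_ge0 g y.
Proof.
rewrite /inv_ge0 /pinv_ splitV/=.
rewrite oinv_surj; case: pselect => [gy|//] /=.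
by case: cid2 => /= z; rewrite in_itv/= andbT.
Qed.

End ClassKinfty.

(** * Comparison of decreasing sequences with [beta_star] *)

Lemma continuous_within_scale {R : realType} (A : set R) (c : R) (g : R -> R) :
  {within A, continuous g} -> {within A, continuous (fun s => c * g s)}.
Proof. by move=> gA z; apply: cvgM; [exact: cvg_cst|exact: gA]. Qed.

(** Strict growth and unboundedness come from [a]; the nondecreasing nonnegative term in [b]
    preserves both. *)
Lemma alpha_Y_bar_Kinfty {R : realType} (a b : R -> R) (gs : R) :
  0 < gs -> class_Kinfty a -> {within `[0, +oo[, continuous b} ->
  (forall s t, 0 <= s -> s <= t -> b s <= b t) -> b 0 = 0 ->
  class_Kinfty (alpha_Y_bar a b gs).
Proof.
move=> gs0 [acont amono aunb a0] bcont bmono b0.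
have gsV : 0 <= gs^-1 by rewrite invr_ge0 ltW.
split.
- by apply: within_continuousD => //; exact: continuous_within_scale.
- move=> s t s0 st; apply: ltr_leD; first exact: amono.
  by apply: ler_wpM2l => //; apply: bmono => //; exact: ltW.
- move=> M; have [s s0 Ms] := aunb M; exists s => //.
  apply: (lt_le_trans Ms); rewrite lerDl mulr_ge0//.
  by rewrite -b0 bmono.
- by rewrite /alpha_Y_bar a0 b0 mulr0 addr0.
Qed.

(* The intermediate value theorem in the coordinate [s = inv_ge0 aY a], which
   spares the continuity of [inv_ge0 aY]. *)
Lemma decrement_surj {R : realType} (aY d : R -> R) (b c : R) :
  class_Kinfty aY -> {within `[0, +oo[, continuous d} -> d 0 = 0 ->
  0 <= b -> 0 <= c <= b - d (inv_ge0 aY b) ->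
  exists2 a, 0 <= a <= b & a - d (inv_ge0 aY a) = c.
Proof.
move=> aYK dcont d0 /(class_Kinfty_surj aYK)[t t0 <-].
rewrite inv_ge0K// => /andP[c0 cb].
have [aYcont _ _ aY0] := aYK.
have cont : {within `[0, t], continuous (aY - d)}.
  have := within_continuousB aYcont dcont.
  apply: continuous_subspaceW => z /=.
  by rewrite !in_itv/= andbT => /andP[].
have [|s + <-] := IVT t0 cont (v := c).
  rewrite (_ : (aY - d) 0 = 0); last by rewrite -[LHS]/(aY 0 - d 0) aY0 d0 subr0.
  by rewrite ge_min c0 le_max -[(aY - d) t]/(aY t - d t) cb orbT.
rewrite in_itv/= => /andP[s0 st]; exists (aY s); last by rewrite inv_ge0K.
by rewrite -{1}aY0 !class_Kinfty_le.
Qed.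

(* [g] need not be monotone, so [y k] is compared with the iterates of [g] at a
   suitable point below [y 0] rather than at [y 0] itself. *)
Lemma iter_preimage_le {R : realType} (g : R -> R) :
  (forall b c, 0 <= b -> 0 <= c <= g b -> exists2 a, 0 <= a <= b & g a = c) ->
  forall (k : nat) (y : nat -> R),
  (forall j, 0 <= y j) -> (forall j, y j.+1 <= g (y j)) ->
  exists2 r, 0 <= r <= y 0%N & iter k g r = y k.
Proof.
move=> gsurj; elim=> [|k IH] y y0 yg; first by exists (y 0%N); rewrite ?y0 ?lexx.
have [||r /andP[r0 r1] ryk] := IH (y \o S).
- by move=> j; exact: y0.
- by move=> j; exact: yg.
have [||a ab gar] := gsurj (y 0%N) r; first exact: y0.
  by rewrite r0 (le_trans r1 (yg 0%N)).
by exists a => //; rewrite iterSr gar.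
Qed.

Lemma class_Kinfty_ge0 {R : realType} {g : R -> R} s :
  class_Kinfty g -> 0 <= s -> 0 <= g s.
Proof. by move=> gK s0; case: (gK) => _ _ _ <-; exact: class_Kinfty_le. Qed.

(** The comparison principle for a Lyapunov sequence: [y] will be Y along an optimal solution and
    [t] the value of [sigma] at time [k]. *)
Lemma le_beta_star {R : realType} (aVs aWb aW : R -> R) (gs gamma : R)
    (y : nat -> R) (s t : R) (k : nat) :
  class_Kinfty (alpha_Y_bar aVs aWb gs) -> class_Kinfty aW ->
  0 <= gamma -> gs <= gamma -> gs <= 1 -> 0 <= s ->
  (forall j, 0 <= y j) -> y 0%N <= alpha_Y_bar aVs aWb gs s ->
  (forall j, y j.+1 <=
     y j - gamma^-1 * alpha_Y_tilde aVs aWb aW gs gamma (y j)) ->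
  aW t <= y k ->
  t <= beta_star aVs aWb aW gs gamma s k.
Proof.
move=> aYK aWK gamma0 gs_gamma gs1 s0 y0 ys yS aWt.
have [aWcont _ _ aW0] := aWK.
have gammaV : 0 <= gamma^-1 by rewrite invr_ge0.
pose step t := t - gamma^-1 * alpha_Y_tilde aVs aWb aW gs gamma t.
have step_le r : step r <= r.
  rewrite gerBl mulr_ge0// mulr_ge0//.
    by rewrite divr_ge0// subr_ge0.
  by apply: class_Kinfty_ge0 => //; exact: inv_ge0_ge0.
have step_surj b c : 0 <= b -> 0 <= c <= step b ->
    exists2 a, 0 <= a <= b & step a = c.
  move=> b0 cb; apply: (decrement_surj _
    (fun s => gamma^-1 * alpha_Y aW gs gamma s) _ _ aYK _ _ b0 cb).
    by do 2!apply: continuous_within_scale.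
  by rewrite /alpha_Y aW0 !mulr0.
have [r /andP[r0 ry] ryk] := iter_preimage_le _ step_surj k y y0 yS.
have y_le : y k <= beta_tilde aVs aWb aW gs gamma (alpha_Y_bar aVs aWb gs s) k.
  rewrite -ryk; apply: ub_le_sup; last first.
    by exists r => //=; rewrite in_itv/= r0 (le_trans ry ys).
  (* The supremum needs a bounded set: as [step] lies below the identity, no iterate exceeds its
     starting point. *)
  exists (alpha_Y_bar aVs aWb gs s) => z [a /=].
  rewrite in_itv/= => /andP[_ a1] <-.
  apply: (le_trans _ a1); elim: (k) => [|m IH]; first exact: lexx.
  exact: le_trans (step_le _) IH.
have [b0 bE] := class_Kinfty_inv_ge0 aWK _ (le_trans (y0 k) y_le).
by apply: (class_Kinfty_le_inv aWK) => //; rewrite bE (le_trans aWt).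
Qed.

(** * Dynamic programming for discounted costs *)

Section Costs.
Context {R : realType} {X I : Type} {f : X -> I -> X} {U : X -> set I}.
Context {ell : X -> I -> R} {gamma : R}.
Hypotheses (ell_ge0 : forall x u, 0 <= ell x u) (gamma_ge0 : 0 <= gamma).
Local Open Scope ereal_scope.

(** [solution] recurses on the last input, whereas dynamic programming splits off the first. *)
Lemma solutionSl x u k :
  solution f x u k.+1 = solution f (f x (u 0%N)) (u \o S) k.
Proof. by elim: k => //= k ->. Qed.

Lemma stage_ge0 x u k : 0 <= (gamma ^+ k * ell x u)%:E.
Proof. by rewrite lee_fin mulr_ge0// exprn_ge0. Qed.

Lemma cost_ge0 x u : 0 <= cost f ell gamma x u.
Proof. by apply: nneseries_ge0 => k _ _; exact: stage_ge0. Qed.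

Lemma policy_cost_ge0 h x : 0 <= policy_cost f ell gamma h x.
Proof. exact: cost_ge0. Qed.

Lemma costS x u :
  cost f ell gamma x u =
  (ell x (u 0%N))%:E + gamma%:E * cost f ell gamma (f x (u 0%N)) (u \o S).
Proof.
rewrite /cost nneseries_recl//; last by move=> k _; exact: stage_ge0.
rewrite /= expr0 mul1r; congr (_ + _).
rewrite -(@nneseries_addn _ _ 1); last by move=> k; exact: stage_ge0.
rewrite -nneseriesZl; last by move=> k _; exact: stage_ge0.
apply: eq_eseriesr => k _.
by rewrite addn1 solutionSl exprS -mulrA EFinM.
Qed.

Lemma feedback_inputsS h x :
  feedback_inputs f h x \o S = feedback_inputs f h (f x (h x)).
Proof. by apply/funext => k; rewrite /feedback_inputs /comp iterSr. Qed.

Lemma policy_costS h x :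
  policy_cost f ell gamma h x =
  (ell x (h x))%:E + gamma%:E * policy_cost f ell gamma h (f x (h x)).
Proof.
by rewrite /policy_cost costS feedback_inputsS.
Qed.

(** A supersolution of the Bellman equation of [h] dominates every partial sum of the cost, by
    induction on the number of terms: unrolling leaves a discounted value of [V], which is dropped
    because it is nonnegative. *)
Lemma policy_cost_le h (V : X -> \bar R) :
  (forall x, 0 <= V x) ->
  (forall x, (ell x (h x))%:E + gamma%:E * V (f x (h x)) <= V x) ->
  forall x, policy_cost f ell gamma h x <= V x.
Proof.
move=> V0 VS x; apply: lime_le.
  by apply: is_cvg_nneseries => k _ _; exact: stage_ge0.
apply: nearW => n; elim: n x => [|n IH] x; first by rewrite big_nil.
apply: le_trans (VS x); rewrite big_nat_recl// expr0 mul1r.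
apply: leeD2l; apply: le_trans (lee_wpmul2l _ (IH _)); last by rewrite lee_fin.
rewrite ge0_sume_distrr; last by move=> k _; exact: stage_ge0.
rewrite le_eqVlt; apply/orP; left; apply/eqP; apply: eq_bigr => k _.
by rewrite -EFinM mulrA -exprS solutionSl -feedback_inputsS.
Qed.

Lemma optimal_cost_ge0 x : 0 <= optimal_cost f U ell gamma x.
Proof. by apply: le_ereal_inf_tmp => _ [u _ <-]; exact: cost_ge0. Qed.

(** Split the first stage off an optimal sequence [w]: its tail is admissible from the successor, so
    it costs at least the optimum there, and [u] does at least as well as [w 0] in the greedy
    objective. *)
Lemma optimal_cost_ge_optimal_input x u :
  optimal_cost_attained f U ell gamma x ->
  optimal_inputs f U ell gamma x u ->
  (ell x u)%:E + gamma%:E * optimal_cost f U ell gamma (f x u)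
    <= optimal_cost f U ell gamma x.
Proof.
move=> [[w wadm <-] _] [_ umin]; rewrite costS.
apply: le_trans (umin _ (wadm 0%N)) _.
apply: leeD2l; apply: lee_wpmul2l; first by rewrite lee_fin.
apply: ge_ereal_inf; exists (cost f ell gamma (f x (w 0%N)) (w \o S)) => //.
by exists (w \o S) => // k; rewrite -solutionSl; exact: wadm.
Qed.

(** * Monotonicity of policy iteration *)

Section PolicyIteration.
Context {h0 : X -> I} {h : nat -> X -> I}.
Hypotheses (h0_adm : admissible_policy U h0).
Hypothesis h_PI : policy_iteration f U ell gamma h0 h.

Lemma policy_iteration_admissible i : admissible_policy U (h i).
Proof.
by case: h_PI => h_0 hS; case: i => [|i] x; [rewrite h_0|have [] := hS i x].
Qed.

(** The cost of [h i] is a supersolution for [h i.+1]: the greedy choice does no worse than [h i],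
    whose objective value is its own cost by [policy_costS]. *)
Lemma policy_improvement i x :
  policy_cost f ell gamma (h i.+1) x <= policy_cost f ell gamma (h i) x.
Proof.
apply: policy_cost_le => [y|y]; first exact: policy_cost_ge0.
have [_ /(_ (h i y) (@policy_iteration_admissible i y))] := h_PI.2 i y.
by rewrite -policy_costS.
Qed.

Lemma policy_cost_le_initial i x :
  policy_cost f ell gamma (h i) x <= policy_cost f ell gamma h0 x.
Proof.
elim: i => [|i IH]; first by rewrite h_PI.1.
exact: le_trans (policy_improvement i x) IH.
Qed.

(** Improvement at the successor state turns the Bellman equation of [h i.+1] into the objective
    that [h i.+1] minimizes. *)
Lemma policy_cost_succ_le i x u : U x u ->
  policy_cost f ell gamma (h i.+1) x <=
  (ell x u)%:E + gamma%:E * policy_cost f ell gamma (h i) (f x u).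
Proof.
move=> Uxu; rewrite policy_costS.
apply: le_trans ((h_PI.2 i x).2 u Uxu).
apply: leeD2l; apply: lee_wpmul2l; first by rewrite lee_fin.
exact: policy_improvement.
Qed.

End PolicyIteration.
End Costs.

Theorem theorem1 (R : realType) (nx nu : nat)
  (f : 'rV[R]_nx -> 'rV[R]_nu -> 'rV[R]_nx)
  (U : 'rV[R]_nx -> set 'rV[R]_nu)
  (ell : 'rV[R]_nx -> 'rV[R]_nu -> R)
  (U_neq0 : forall x, U x !=set0)
  (ell_ge0 : forall x u, 0 <= ell x u)
  (sigma : 'rV[R]_nx -> R) (sigmaP : state_measure sigma)
  (h0 : 'rV[R]_nx -> 'rV[R]_nu) (h0_adm : admissible_policy U h0)
  (* (A1) *)
  (A1 : forall x gamma, 0 < gamma < 1 ->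
     optimal_cost_attained f U ell gamma x)
  (* (A3) *)
  (W : 'rV[R]_nx -> R) (alpha_W alpha_W_bar : R -> R)
  (W_ge0 : forall x, 0 <= W x) (W_cont : continuous W)
  (alpha_W_Kinfty : class_Kinfty alpha_W)
  (alpha_W_bar_cont : {within `[0, +oo[, continuous alpha_W_bar})
  (alpha_W_bar_nd : forall s t, 0 <= s -> s <= t ->
     alpha_W_bar s <= alpha_W_bar t)
  (alpha_W_bar0 : alpha_W_bar 0 = 0)
  (A3 : forall x u, U x u ->
     W x <= alpha_W_bar (sigma x) /\
     W (f x u) - W x <= - alpha_W (sigma x) + ell x u)
  (* (A4) *)
  (gamma0 : R) (gamma0_bnd : 0 < gamma0 <= 1)
  (alpha_V_bar : R -> R -> R)
  (alpha_V_bar_Kinfty : forall gamma, 0 < gamma < gamma0 ->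
     class_Kinfty (fun s => alpha_V_bar s gamma))
  (A4 : forall x gamma, 0 < gamma < gamma0 ->
     (policy_cost f ell gamma h0 x <= (alpha_V_bar (sigma x) gamma)%:E)%E)
  (* (A5) *)
  (alpha_Vs_bar : R -> R) (alpha_Vs_bar_Kinfty : class_Kinfty alpha_Vs_bar)
  (A5i : forall x gamma, 0 < gamma < gamma0 ->
     (optimal_cost f U ell gamma x <= (alpha_Vs_bar (sigma x))%:E)%E)
  (gamma_s : R) (gamma_s_bnd : 0 < gamma_s < gamma0)
  (A5ii : forall s, 0 < s -> (1 - gamma_s) * alpha_Vs_bar s <= alpha_W s)
  (gamma : R) (gamma_bnd : gamma_s < gamma < gamma0)
  (* a run of policy iteration, with (A2) *)
  (h : nat -> 'rV[R]_nx -> 'rV[R]_nu)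
  (h_PI : policy_iteration f U ell gamma h0 h)
  (A2 : forall i x, improved_inputs f U ell gamma h i x !=set0)
  (i : nat) (x : 'rV[R]_nx)
  (phi : nat -> 'rV[R]_nx) (phiP : optimal_solution f U ell gamma x phi) :
  let V := fun j => policy_cost f ell gamma (h j) in
  let Vs := optimal_cost f U ell gamma in
  let beta := beta_star alpha_Vs_bar alpha_W_bar alpha_W gamma_s gamma in
  (V i x - Vs x <= (gamma ^+ i)%:E * (V 0%N (phi i) - Vs (phi i)))%E /\
  ((gamma ^+ i)%:E * (V 0%N (phi i) - Vs (phi i))
     <= (gamma ^+ i * alpha_V_bar (beta (sigma x) i) gamma)%:E)%E.
Proof.
move=> V Vs beta.
have [gs0 gs_gamma0] := andP gamma_s_bnd.
have [_ gamma01] := andP gamma0_bnd.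
have [gs_gamma gamma_gamma0] := andP gamma_bnd.
have gamma_gt0 : 0 < gamma := lt_trans gs0 gs_gamma.
have gamma_in0 : 0 < gamma < gamma0 by rewrite gamma_gt0.
have gamma_in1 : 0 < gamma < 1 by rewrite gamma_gt0 (lt_le_trans gamma_gamma0).
have gamma_ge0 := ltW gamma_gt0.
have gs_lt1 : gamma_s < 1 by lra.
have sigma_ge0 z : 0 <= sigma z by case: sigmaP.
have h_0 : h 0%N = h0 by case: h_PI.
(* All costs are finite, by A1 for [Vs] and by A4 with monotonicity for [V j], so the argument can
   move to real numbers. *)
have Vs_fin z : Vs z \is a fin_num.
  by rewrite ge0_fin_numE ?optimal_cost_ge0//; case: (A1 z _ gamma_in1).
have V_fin j z : V j z \is a fin_num.
  rewrite ge0_fin_numE ?policy_cost_ge0//.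
  apply: le_lt_trans (policy_cost_le_initial ell_ge0 gamma_ge0 h0_adm h_PI j z) _.
  exact: le_lt_trans (A4 z _ gamma_in0) (ltry _).
pose v j z := fine (V j z); pose vs z := fine (Vs z).
have vE j z : V j z = (v j z)%:E by rewrite fineK.
have vsE z : Vs z = (vs z)%:E by rewrite fineK.
have vs_ge0 z : 0 <= vs z by rewrite -lee_fin -vsE optimal_cost_ge0.
have v_le z : v 0%N z <= alpha_V_bar (sigma z) gamma.
  by rewrite -lee_fin -vE /V h_0; exact: A4.
have vs_le z : vs z <= alpha_Vs_bar (sigma z).
  by rewrite -lee_fin -vsE; exact: A5i.
have vs_step y z : (f y @` optimal_inputs f U ell gamma y) z ->
    exists u, [/\ U y u, f y u = z & ell y u + gamma * vs z <= vs y].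
  move=> [u uopt <-]; exists u; split=> //; first by case: uopt.
  rewrite -lee_fin EFinD EFinM -!vsE.
  by apply: optimal_cost_ge_optimal_input => //; exact: A1.
have v_step j y u : U y u -> v j.+1 y <= ell y u + gamma * v j (f y u).
  move=> Uyu; rewrite -lee_fin EFinD EFinM -!vE.
  exact: (policy_cost_succ_le ell_ge0 gamma_ge0 h0_adm h_PI).
rewrite !vE !vsE -!EFinB -EFinM !lee_fin; case: phiP => phi0 phiS; split.
  (* The induction generalizes over [phi]: the hypothesis is used on the shifted solution, which
     starts at [phi 1]. *)
  rewrite -{}phi0; elim: i phi phiS => [|i IH] phi phiS; first by rewrite mul1r.
  have [u [Uu fu vsu]] := vs_step _ _ (phiS 0%N).
  have := v_step i _ _ Uu; rewrite fu => viu.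
  have := IH (phi \o S) (fun k => phiS k.+1) => /= IHphi.
  have := ler_wpM2l gamma_ge0 IHphi; rewrite mulrA -exprS; lra.
have aYK : class_Kinfty (alpha_Y_bar alpha_Vs_bar alpha_W_bar gamma_s).
  exact: alpha_Y_bar_Kinfty.
pose y j := vs (phi j) + gamma^-1 * W (phi j).
have gammaV : 0 < gamma^-1 by rewrite invr_gt0.
have y_ge0 j : 0 <= y j by rewrite addr_ge0// mulr_ge0// ltW.
have y_le j : y j <= alpha_Y_bar alpha_Vs_bar alpha_W_bar gamma_s (sigma (phi j)).
  have [u [Uu _ _]] := vs_step _ _ (phiS j).
  have [Wj _] := A3 _ _ Uu.
  (* Since [gamma_s < gamma], the weight 1/gamma is at most the weight 1/gamma_s of
     [alpha_Y_bar]. *)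
  apply: lerD => //; apply: ler_pM => //; first exact: ltW.
  by rewrite lef_pV2// ltW.
have A5ii0 s : 0 <= s -> (1 - gamma_s) * alpha_Vs_bar s <= alpha_W s.
  rewrite le_eqVlt => /predU1P[<-|]; last exact: A5ii.
  case: alpha_W_Kinfty => _ _ _ ->; case: alpha_Vs_bar_Kinfty => _ _ _ ->.
  by rewrite mulr0.
have sigma_le : sigma (phi i) <= beta (sigma x) i.
  apply: (le_beta_star _ _ _ _ _ y) => //; [exact: ltW|exact: ltW| | | ].
  - by rewrite -phi0.
  - move=> j.
    set a := alpha_Y_tilde _ _ _ _ _ _.
    (* By [y_le], the inverse of [alpha_Y_bar] at [y j] is at most [sigma (phi j)]. *)
    have aj : (1 - gamma_s) * a <= (gamma - gamma_s) * alpha_W (sigma (phi j)).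
      rewrite /a /alpha_Y_tilde /alpha_Y mulrA mulrCA divff ?mulr1; last by lra.
      apply: ler_wpM2l; first by lra.
      apply: (class_Kinfty_le alpha_W_Kinfty); first exact: inv_ge0_ge0.
      apply: (class_Kinfty_le_inv aYK) => //.
      by rewrite (class_Kinfty_inv_ge0 aYK _ (y_ge0 j)).2.
    clearbody a.
    have [u [Uu fu vsu]] := vs_step _ _ (phiS j).
    have [_] := A3 _ _ Uu; rewrite fu => Wj.
    have := A5ii0 _ (sigma_ge0 (phi j)) => A5j.
    have vsj := vs_le (phi j).
    rewrite -(ler_pM2l gamma_gt0) /y mulrBr !mulrDr !mulrA divff ?gt_eqF// !mul1r.
    (* Adding [vsu] and [Wj] cancels the stage cost; replacing Vs by gamma Vs on the right then
       costs (1 - gamma) Vs. *)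
    suff : (1 - gamma) * vs (phi j) + a <= alpha_W (sigma (phi j)) by lra.
    (* After scaling, A5 bounds the first term by (1 - gamma) alpha_W and [aj] the second by (gamma
       - gamma_s) alpha_W; the weights add up to 1 - gamma_s. *)
    rewrite -(ler_pM2l (_ : 0 < 1 - gamma_s)); last by lra.
    have : (1 - gamma) * ((1 - gamma_s) * vs (phi j)) <=
        (1 - gamma) * alpha_W (sigma (phi j)).
      apply: ler_wpM2l; first by lra.
      apply: le_trans A5j; apply: ler_wpM2l => //; lra.
    lra.
  (* Lower bound on Y: A3 gives alpha_W(sigma) <= W + ell, where ell <= Vs by [vsu] and W <= W /
     gamma because gamma < 1. *)
  - have [u [Uu fu vsu]] := vs_step _ _ (phiS i).
    have [_] := A3 _ _ Uu; rewrite fu => Wi.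
    have Wy : W (phi i) <= gamma^-1 * W (phi i).
      by apply: ler_peMl => //; rewrite invf_ge1//; lra.
    have := mulr_ge0 gamma_ge0 (vs_ge0 (phi i.+1)).
    have := W_ge0 (phi i.+1); rewrite /y; lra.
apply: ler_wpM2l; first exact: exprn_ge0.
apply: (@le_trans _ _ (v 0%N (phi i))); first by rewrite gerBl.
apply: le_trans (v_le _) _.
exact: (class_Kinfty_le (alpha_V_bar_Kinfty _ gamma_in0)).
Qed.
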